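(* Let $G=(V,E)$ be a connected, loopless and bridgeless graph with $n$ vertices and $m$ edges, and write $T(G;x,y)=\sum_{i,j}t_{i,j}x^iy^j$. Let $p(G)$ be the number of parallel classes and $p^*(G)$ the number of non-trivial parallel classes of $G$, and let $\Delta(\tilde G)$ be the number of triangles of $\tilde G$, the simple graph obtained from $G$ by replacing each parallel class by a single edge. Then \begin{enumerate} \item $t_{n-1,0}=1$; \item $t_{n-2,0}=p(G)-n+1$; \item $t_{n-3,0}=\binom{n-1}{2}-(n-2)\,p(G)+\binom{p(G)}{2}-\Delta(\tilde G)$; \item $t_{n-2,1}=p^*(G)$; \item $t_{n-3,1}=-p^*(G)(n-2)+\sum_{A}p(G/A)+\Delta(\tilde G)$, where the sum runs over all non-trivial parallel classes $A\subseteq E$ of $G$ and $G/A$ is the graph obtained by contracting all edges of $A$. \end{enumerate}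
   Context: Graphs are finite and may have parallel edges. The Tutte polynomial is $T(G;x,y)=\sum_{A\subseteq E}(x-1)^{\rho(E)-\rho(A)}(y-1)^{\gamma(A)}$, where for $A\subseteq E$, $c(A)$ is the number of connected components of the spanning subgraph $(V,A)$, $\rho(A)=|V|-c(A)$, $\gamma(A)=|A|-|V|+c(A)$. A parallel class of $G$ is a maximal subset of $E$ all of whose edges have the same pair of endvertices; parallel classes partition $E$. A parallel class is trivial if it has exactly one edge, non-trivial otherwise. *)

(* Defs.v *)
From HB Require Import structures.
From mathcomp Require Import all_boot all_order all_algebra.
Set Implicit Arguments. Unset Strict Implicit. Unset Printing Implicit Defensive.
Import Order.TTheory GRing.Theory Num.Theory.

(* A finite multigraph (parallel edges allowed) is given by a vertex type V,
   an edge type E and two endpoint maps src tgt : E -> V (orientation is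
   irrelevant: every notion below only uses the unordered pair of endpoints). *)
Section Graph.
Variables (V E : finType) (src tgt : E -> V).

Definition endset (e : E) : {set V} := [set src e; tgt e].

Definition adjA (A : {set E}) : rel V :=
  fun x y => [exists e in A, ((src e == x) && (tgt e == y)) ||
                             ((tgt e == x) && (src e == y))].

Definition ncomp (A : {set E}) : nat := n_comp (adjA A) [pred x : V | true].

(* rho(A) = |V| - c(A),  gamma(A) = |A| - |V| + c(A) (both are >= 0) *)
Definition rk (A : {set E}) : nat := #|V| - ncomp A.
Definition nullity (A : {set E}) : nat := (#|A| + ncomp A) - #|V|.

(* The Tutte polynomial as an element of Z[y][x]: the outer variable is x,
   the inner (coefficient) variable is y. *)
Definition tutte : {poly {poly int}} :=
  \sum_(A : {set E})
     (('X - 1) ^+ (rk setT - rk A) * (('X - 1) ^+ nullity A)%:P)%R.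

Definition tcoef (i j : int) : int :=
  match i, j with
  | Posz i', Posz j' => (tutte`_i')`_j'
  | _, _ => 0%R
  end.

Definition loopless : Prop := forall e : E, src e != tgt e.
Definition connected : Prop := ncomp setT = 1%N.
Definition is_bridge (e : E) : bool := ncomp setT < ncomp (setT :\ e).
Definition bridgeless : Prop := forall e : E, ~~ is_bridge e.

End Graph.

Definition pclasses (V E : finType) (s t : E -> V) (F : {set E})
  : {set {set E}} :=
  [set [set f in F | endset s t f == endset s t e] | e in F].

Definition npar (V E : finType) (src tgt : E -> V) : nat :=
  #|pclasses src tgt setT|.
Definition npar_nontriv (V E : finType) (src tgt : E -> V) : nat :=
  #|[set A in pclasses src tgt setT | 1 < #|A|]|.

(* Contraction G/A: the vertices of G/A are the connected components of (V,A),
   each represented by its canonical root (root (adjA A)); the edges are those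
   of E \ A, with endpoints mapped to the roots of their components. *)
Definition contr_src (V E : finType) (src tgt : E -> V) (A : {set E})
  (e : E) : V := fingraph.root (adjA src tgt A) (src e).
Definition contr_tgt (V E : finType) (src tgt : E -> V) (A : {set E})
  (e : E) : V := fingraph.root (adjA src tgt A) (tgt e).

Definition npar_contr (V E : finType) (src tgt : E -> V) (A : {set E}) : nat :=
  #|pclasses (contr_src src tgt A) (contr_tgt src tgt A) (~: A)|.

Definition sadj (V E : finType) (src tgt : E -> V) (x y : V) : bool :=
  (x != y) && [exists e, endset src tgt e == [set x; y]].

Definition ntriangles (V E : finType) (src tgt : E -> V) : nat :=
  #|[set S : {set V} | (#|S| == 3) &&
      [forall x in S, forall y in S, (x != y) ==> sadj src tgt x y]]|.

(* Main.v *)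
Require Import Defs.
From HB Require Import structures.
From mathcomp Require Import all_boot all_order all_algebra ring.
Import Order.TTheory GRing.Theory Num.Theory.
Set Implicit Arguments. Unset Strict Implicit. Unset Printing Implicit Defensive.

(** With [r = n - 1] and [q = y - 1], grouping the subgraph expansion by rank
    gives [T = \sum_k (x - 1)^(r - k) W_k] where [W_k] is the sum of
    [q^(nullity A)] over the edge sets [A] of rank [k]; hence only
    [W_0], [W_1] and [W_2] contribute to the coefficients of [x^(r - j)],
    [j <= 2].  The rank of [A] depends only on the set [S] of endpoint pairs
    of its edges, and summing over all [A] with the same [S] gives

      [q^k W_k = \sum_(S of rank k) \prod_(C in S) (y^(m_C) - 1)
               = \sum_(S of rank k) q^#|S| \prod_(C in S) (1 + y + ... + y^(m_C - 1))]

    where [m_C] is the size of the parallel class [C].  A set [S] of pairs has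
    rank 1 iff it is a singleton, and rank 2 iff it consists of two pairs or is
    a triangle, so the constant and linear coefficients in [y] of [W_1] and
    [W_2] can be read off.  Finally, contracting a class [C] loses, besides [C]
    itself, one parallel class for every triangle through [C]. *)

(** * Rank of a set of vertex pairs *)

Section PairSets.
Variable V : finType.
Implicit Types (x y : V) (C D T : {set V}) (S : {set {set V}}).

Definition pair_adj S : rel V := fun x y => [set x; y] \in S.

(** The rank of the simple graph with edge set [S]. By [ncomp_le] the truncated subtraction is a
    true one. *)
Definition pair_rank S : nat := #|V| - n_comp (pair_adj S) [pred x : V | true].

Definition pairs T : {set {set V}} := [set C : {set V} | C \subset T & #|C| == 2].

Lemma pair_adj_sym S : symmetric (pair_adj S).
Proof. by move=> x y; rewrite /pair_adj setUC. Qed.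

Lemma connect_pair_sym S : connect_sym (pair_adj S).
Proof. exact/sym_connect_sym/pair_adj_sym. Qed.

Lemma ncomp_le S : n_comp (pair_adj S) [pred x : V | true] <= #|V|.
Proof. exact: max_card. Qed.

(** The union [a] of the components of [x] and [y] is closed both before and after the pair is
    added. Inside [a] there are one or two components before and exactly one after; outside [a]
    nothing changes. *)
Lemma ncomp_add S x y :
  n_comp (pair_adj S) [pred x : V | true] =
  n_comp (pair_adj ([set x; y] |: S)) [pred x : V | true]
    + ~~ connect (pair_adj S) x y.
Proof.
set S' := _ |: S; set e := pair_adj S; set e' := pair_adj S'.
have symS := connect_pair_sym S; have symS' := connect_pair_sym S'.
have sSS : subrel e e' by move=> u v; rewrite /e /e' /pair_adj in_setU1 => ->; rewrite orbT.
have xy' : connect e' x y by apply: connect1; rewrite /e' /pair_adj setU11.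
pose a : pred V := closure e (pred2 x y).
have xa : x \in a by apply: mem_closure; rewrite !inE eqxx.
have ya : y \in a by apply: mem_closure; rewrite !inE eqxx orbT.
have cla : closed e a := closure_closed symS (pred2 x y).
have ee' u v : u \notin a -> e' u v = e u v.
  move=> ua; rewrite /e' /e /pair_adj in_setU1; case: eqP => //= euv.
  have : u \in [set x; y] by rewrite -euv set21.
  by rewrite !inE => /orP[] /eqP eu; rewrite eu ?xa ?ya in ua.
have cla' : closed e' a.
  apply: (intro_closed symS') => u v uv ua; apply: contraLR uv => va.
  rewrite /e' pair_adj_sym -/e' ee' //.
  apply: contraNN va => vu; suff -> : v \in a = (u \in a) by [].
  exact: cla vu.
have aE : a =i closure e' (pred2 x y).
  move=> u; apply/idP/idP.
    rewrite !unfold_in => /pred0Pn [v /andP[uv vxy]]; apply/pred0Pn; exists v.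
    apply/andP; split => //; apply: connect_sub uv => w z wz.
    exact/connect1/sSS.
  rewrite unfold_in => /pred0Pn [v /andP[uv vxy]].
  rewrite (closed_connect cla' uv).
  by move: vxy; rewrite !inE => /orP[] /eqP ->.
have conn u : u \notin a -> connect e u =1 connect e' u.
  move=> ua v; apply/idP/idP; first by apply: connect_sub => w z wz; apply/connect1/sSS.
  case/connectP => p; elim: p u ua => [|w p IHp] u ua /=; first by move=> _ ->; rewrite connect0.
  case/andP => uw pp vE; rewrite (ee' _ _ ua) in uw.
  apply: (connect_trans (connect1 uw)); apply: IHp => //.
  by rewrite -(cla _ _ uw).
rewrite (n_compC a e) (n_compC a e') (n_comp_closure2 symS x y).
rewrite (eq_n_comp_r aE) (n_comp_closure2 symS' x y) xy' /=.
suff -> : n_comp e [predC a] = n_comp e' [predC a] by rewrite addSn add1n addSn addnC.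
(* Components are counted by their roots, and [root] is picked from the connectivity class alone, so
   equal classes off [a] have equal roots. *)
rewrite /n_comp_mem; apply: eq_card => u; rewrite !inE.
case: (boolP (u \in a)) => ua; first by rewrite !andbF.
by rewrite /roots /fingraph.root (eq_pick (conn u ua)).
Qed.

Lemma pair_rank_add S x y :
  pair_rank ([set x; y] |: S) = pair_rank S + ~~ connect (pair_adj S) x y.
Proof.
rewrite /pair_rank (ncomp_add S x y).
have := ncomp_le S; rewrite (ncomp_add S x y) => le.
by rewrite subnDA subnK // leq_subRL // (leq_trans _ le) ?leq_addr.
Qed.

Lemma connect_pair0 x y : connect (pair_adj set0) x y = (x == y).
Proof.
apply/idP/eqP => [/connectP [[|z p] /=]|->]; rewrite ?connect0 //.
by rewrite /pair_adj inE.
Qed.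

Lemma pair_rank0 : pair_rank set0 = 0.
Proof.
apply/eqP; rewrite subn_eq0 /n_comp_mem; apply/subset_leq_card/subsetP => x _.
rewrite !inE andbT /roots eq_sym -connect_pair0; exact: connect_root.
Qed.

(** Add the missing pairs one at a time: each raises the rank by 0 or 1. *)
Lemma pair_rank_mono S1 S2 : {in S2, forall C, #|C| == 2} ->
  S1 \subset S2 -> pair_rank S1 <= pair_rank S2 <= pair_rank S1 + #|S2 :\: S1|.
Proof.
move: {2}_.+1 (ltnSn #|S2 :\: S1|) => n; elim: n S1 => // n IHn S1 le2 h2 s12.
have [e0|[C CD]] := set_0Vmem (S2 :\: S1).
  rewrite e0 cards0 addn0; suff -> : S1 = S2 by rewrite leqnn.
  by apply/eqP; rewrite eqEsubset s12 -setD_eq0 e0 eqxx.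
have /setDP [C2 C1] := CD.
have /cards2P [x [y [_ Cxy]]] := h2 _ C2.
have eD : S2 :\: (C |: S1) = (S2 :\: S1) :\ C by rewrite setDDl setUC.
have cD := cardsD1 C (S2 :\: S1); rewrite CD -eD in cD.
have := IHn (C |: S1); rewrite cD ltnS add1n in le2.
rewrite le2 subUset sub1set C2 s12 => /(_ isT h2 isT) /andP[].
rewrite cD Cxy pair_rank_add => le1 le3.
rewrite (leq_trans (leq_addr _ _) le1) (leq_trans le3) //.
by rewrite -addnA leq_add2l leq_add2r leq_b1.
Qed.

Lemma pair_rank_le S : {in S, forall C, #|C| == 2} -> pair_rank S <= #|S|.
Proof.
by move=> h2; have := pair_rank_mono h2 (sub0set S); rewrite pair_rank0 setD0 => /andP[].
Qed.

Lemma pair_rank1 C : #|C| == 2 -> pair_rank [set C] = 1.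
Proof.
move=> /cards2P [x [y [xy ->]]].
by rewrite -[[set _]]setU0 pair_rank_add pair_rank0 connect_pair0 xy.
Qed.

(** If no pair of [S] leaves [C], then [C] is a union of components. *)
Lemma connect_pair_closed S C x y : {in S, forall D, (D \subset C) || [disjoint D & C]} ->
  connect (pair_adj S) x y -> (x \in C) = (y \in C).
Proof.
move=> h; apply: closed_connect; apply: (intro_closed (connect_pair_sym S)).
move=> u v /h /orP[/subsetP s _|d uC]; first by apply: s; rewrite set22.
by have := disjointFr d (set21 u v); rewrite uC.
Qed.

Lemma pair_sub C D : #|C| == 2 -> #|D| == 2 -> C \subset D -> C = D.
Proof. by move=> /eqP c2 /eqP d2 s; apply/eqP; rewrite eqEcard s c2 d2. Qed.

Lemma connect_cover S x y : connect (pair_adj S) x y -> x \in cover S \/ x = y.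
Proof.
case/connectP => [[|z p] /=]; first by move=> _ ->; right.
case/andP => xz _ _; left; apply/bigcupP; exists [set x; z] => //; exact: set21.
Qed.

Lemma connect_pair1 C x y : #|C| == 2 ->
  connect (pair_adj [set C]) x y = (x == y) || (C == [set x; y]).
Proof.
move=> C2; apply/idP/idP => [xy|]; last first.
  case/orP => [/eqP ->|/eqP ->]; rewrite ?connect0 //.
  by apply: connect1; rewrite /pair_adj set11.
case: (altP (x =P y)) => //= nxy; rewrite eq_sym; apply/eqP/pair_sub => //.
  by rewrite cards2 nxy.
have [] := connect_cover xy; last by move/eqP; rewrite (negPf nxy).
rewrite /cover big_set1 => xC; rewrite subUset !sub1set xC /=.
rewrite -(connect_pair_closed _ xy) // => D /set1P ->; by rewrite subxx.
Qed.

Lemma pair_rank2 C D : #|C| == 2 -> #|D| == 2 -> C != D ->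
  pair_rank [set C; D] = 2.
Proof.
move=> C2 /cards2P [x [y [xy ->]]] nCD.
by rewrite setUC pair_rank_add pair_rank1 // connect_pair1 // (negPf xy) (negPf nCD).
Qed.

Lemma pair_rank_eq0 S : {in S, forall C, #|C| == 2} -> (pair_rank S == 0) = (S == set0).
Proof.
move=> h2; have [->|[C CS]] := set_0Vmem S; first by rewrite pair_rank0 !eqxx.
have := pair_rank_mono h2 (_ : [set C] \subset S); rewrite sub1set pair_rank1 ?h2 //.
move=> /(_ CS) /andP[le _]; rewrite gtn_eqF //; apply/esym/negbTE.
by apply: contraTneq CS => ->; rewrite inE.
Qed.

Lemma pair_rank_ge2 S C D : {in S, forall C, #|C| == 2} ->
  C \in S -> D \in S -> C != D -> 2 <= pair_rank S.
Proof.
move=> h2 CS DS CD; rewrite -(pair_rank2 (h2 _ CS) (h2 _ DS) CD).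
have := @pair_rank_mono [set C; D] S h2; rewrite subUset !sub1set CS DS.
by move=> /(_ isT) /andP[].
Qed.

Lemma pair_rank_eq1 S : {in S, forall C, #|C| == 2} -> (pair_rank S == 1) = (#|S| == 1).
Proof.
move=> h2; apply/idP/cards1P => [r1|[C eS]]; last first.
  by rewrite eS pair_rank1 // h2 // eS set11.
have [S0|[C CS]] := set_0Vmem S; first by rewrite S0 pair_rank0 in r1.
exists C; apply/eqP; rewrite eqEsubset sub1set CS andbT; apply/subsetP => D DS.
rewrite inE; apply: contraLR r1 => nDC.
by rewrite gtn_eqF // (pair_rank_ge2 h2 DS CS nDC).
Qed.

Lemma pairs3 x y z : x != y -> x != z -> y != z ->
  pairs [set x; y; z] = [set [set x; y]; [set x; z]; [set y; z]].
Proof.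
move=> xy xz yz; apply/setP => C; rewrite !inE; apply/andP/idP; last first.
  case/orP => [/orP[]|] /eqP ->; rewrite cards2 ?xy ?xz ?yz; split => //;
  by rewrite subUset !sub1set !inE !eqxx ?orbT.
case=> sC /cards2P [u [v [uv eC]]]; move: sC; rewrite eC subUset !sub1set !inE.
move=> /andP [/orP[/orP[]|] /eqP eu /orP[/orP[]|] /eqP ev]; move: uv; rewrite eu ev ?eqxx //= => _;
by rewrite ?eqxx ?orbT // ?[[set y; x]]setUC ?[[set z; x]]setUC ?[[set z; y]]setUC eqxx ?orbT.
Qed.

(** Two pairs that join [x] to [y], neither being the pair of [x] and [y] itself, must form a path
    of length two; [z] is its middle vertex. *)
Lemma connect_pair2 C D x y : #|C| == 2 -> #|D| == 2 -> C != D ->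
  x != y -> [set x; y] != C -> [set x; y] != D ->
  connect (pair_adj [set C; D]) x y ->
  exists z, [/\ z != x, z != y & [set C; D] = [set [set z; x]; [set z; y]]].
Proof.
move=> C2 D2 CD xy xyC xyD con.
have con' : connect (pair_adj [set C; D]) y x by rewrite connect_pair_sym.
wlog xC : C D C2 D2 CD xyC xyD con con' / x \in C.
  move=> H; have [] := connect_cover con; last by move/eqP; rewrite (negPf xy).
  rewrite /cover bigcup_setU !big_set1 inE => /orP[]; first exact: H.
  rewrite setUC in con con' *; apply: H => //; by rewrite eq_sym.
have yC : y \notin C.
  apply: contraNN xyC => yC; apply/eqP/pair_sub; rewrite ?cards2 ?xy //.
  by rewrite subUset !sub1set xC.
have yD : y \in D.
  have [] := connect_cover con'; last by move/eqP; rewrite eq_sym (negPf xy).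
  by rewrite /cover bigcup_setU !big_set1 inE (negPf yC).
(* If [C] and [D] were disjoint, [C] would be a union of components containing [x] but not [y]. *)
have /pred0Pn [z /andP [/= zC zD]] : ~~ [disjoint C & D].
  apply/negP => dCD; move: yC; rewrite -(connect_pair_closed _ con) ?xC //.
  move=> F /set2P [] ->; rewrite ?subxx // disjoint_sym; by rewrite dCD orbT.
have xD : x \notin D.
  apply: contraNN xyD => xD; apply/eqP/pair_sub; rewrite ?cards2 ?xy //.
  by rewrite subUset !sub1set xD.
have zx : z != x by apply: contraNneq xD => <-.
have zy : z != y by apply: contraNneq yC => <-.
exists z; split => //; congr [set _; _]; apply/esym/pair_sub;
  rewrite ?cards2 ?zx ?zy // subUset !sub1set ?zC ?zD //.
Qed.

Lemma card3P T : reflect (exists x y z, [/\ x != y, x != z, y != z & T = [set x; y; z]])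
  (#|T| == 3).
Proof.
apply: (iffP idP) => [|[x [y [z [xy xz yz ->]]]]]; last first.
  by rewrite setUC cardsU1 cards2 xy !inE ![z == _]eq_sym negb_or xz yz.
move=> T3; have [T0|[x xT]] := set_0Vmem T; first by rewrite T0 cards0 in T3.
have := cardsD1 x T; rewrite xT (eqP T3) => -[] /esym/eqP/cards2P [y [z [yz eT]]].
have : y \in T :\ x by rewrite eT set21.
have : z \in T :\ x by rewrite eT set22.
rewrite !inE => /andP[zx _] /andP[yx _].
exists x, y, z; rewrite eq_sym yx eq_sym zx yz; split=> //.
by rewrite -(setD1K xT) eT setUA.
Qed.

(** Fix two pairs [C] and [D] of [S]. Any further pair must keep the rank at 2, hence close a
    triangle with [C] and [D], and only one pair can do so. *)
Lemma pair_rank_eq2 S : {in S, forall C, #|C| == 2} ->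
  (pair_rank S == 2) = (#|S| == 2) || [exists T : {set V}, (#|T| == 3) && (S == pairs T)].
Proof.
move=> h2; apply/idP/orP; last first.
  case=> [/cards2P [C [D [CD eS]]]|].
    by rewrite eS pair_rank2 // h2 // eS ?set21 ?set22.
  case/existsP => T /andP [/card3P [x [y [z [xy xz yz ->]]]]] /eqP ->.
  rewrite pairs3 // setUC pair_rank_add pair_rank2 ?cards2 ?xy ?xz //.
    suff -> : connect (pair_adj [set [set x; y]; [set x; z]]) y z by [].
    apply: (@connect_trans _ _ x); apply: connect1; rewrite /pair_adj.
      by rewrite setUC set21.
    by rewrite set22.
  apply/eqP => /setP /(_ y); rewrite !inE eqxx orbT.
  by rewrite eq_sym (negPf xy) (negPf yz).
move=> r2; case: (altP (#|S| =P 2)) => [|S2]; [by left|right].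
have S2' : 2 < #|S| by rewrite ltn_neqAle eq_sym S2 -(eqP r2) pair_rank_le.
have /card_gt1P [C [D [CS DS CD]]] : 1 < #|S| by apply: ltnW.
have sCD : [set C; D] \subset S by rewrite subUset !sub1set CS.
have C2 := h2 _ CS; have D2 := h2 _ DS.
have key F : F \in S -> F != C -> F != D -> exists x y z,
    [/\ z != x, z != y, x != y, F = [set x; y] & [set C; D] = [set [set z; x]; [set z; y]]].
  move=> FS FC FD; have /cards2P [x [y [xy eF]]] := h2 _ FS.
  (* Otherwise [F], [C] and [D] together would already have rank 3. *)
  have con : connect (pair_adj [set C; D]) x y.
    apply: contraLR r2 => ncon; rewrite gtn_eqF //.
    have := @pair_rank_mono (F |: [set C; D]) S h2.
    rewrite subUset sub1set FS sCD => /(_ isT) /andP[] + _; apply: leq_trans.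
    by rewrite eF pair_rank_add pair_rank2 // ncon.
  rewrite eF in FC FD.
  have [z [zx zy e]] := connect_pair2 C2 D2 CD xy FC FD con.
  by exists x, y, z.
have [F] : exists F, F \in S :\: [set C; D].
  apply/set0Pn; rewrite setD_eq0; apply: contraTN S2' => /subset_leq_card.
  by rewrite cards2 CD -leqNgt.
rewrite !inE negb_or => /andP[/andP[FC FD] FS].
have [x [y [z [zx zy xy eF eCD]]]] := key F FS FC FD.
apply/existsP; exists [set z; x; y]; apply/andP; split.
  by apply/card3P; exists z, x, y.
rewrite pairs3 // -eCD -eF eqEsubset [X in _ && X]subUset sCD sub1set FS !andbT.
apply/subsetP => G GS; rewrite !inE.
case: (altP (G =P C)) => //= GC; case: (altP (G =P D)) => //= GD.
have [x' [y' [z' [zx' zy' xy' eG eCD']]]] := key G GS GC GD.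
(* The third pair is the symmetric difference of [C] and [D], hence unique. *)
have eC u u' w (uw : w != u) (uw' : w != u') (uu: u != u') :
   [set C; D] = [set [set w; u]; [set w; u']] -> cover [set C; D] = [set w; u; u'].
  move=> ->; rewrite /cover bigcup_setU !big_set1; apply/setP => v; rewrite !inE.
  by case: (v == w); rewrite //= orbC.
have eI u u' w (uw : w != u) (uw' : w != u') (uu: u != u') :
   [set C; D] = [set [set w; u]; [set w; u']] -> C :&: D = [set w].
  move=> e; have /set2P eCC : C \in [set [set w; u]; [set w; u']] by rewrite -e set21.
  have /set2P eDD : D \in [set [set w; u]; [set w; u']] by rewrite -e set22.
  have wuu' : [set w; u] :&: [set w; u'] = [set w].
    by rewrite -setUIr (disjoint_setI0 _) ?setU0 // disjoints1 inE.
  by case: eCC eDD CD => -> [] ->; rewrite ?eqxx // setIC.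
have eF' u u' w (uw : w != u) (uw' : w != u') (uu: u != u') :
   [set C; D] = [set [set w; u]; [set w; u']] -> [set u; u'] = cover [set C; D] :\: (C :&: D).
  move=> e; rewrite (eC u u' w) // (eI u u' w) //; apply/setP => v; rewrite !inE.
  case: (v =P w) => [->|] //=; by rewrite (negPf uw) (negPf uw').
by apply/eqP; rewrite eF eG (eF' x y z) // (eF' x' y' z').
Qed.

End PairSets.

(** * Counting pairs and triangles *)

Section PairCounts.
Variables (V : finType) (P : {set {set V}}).
Hypothesis card_P : {in P, forall C : {set V}, #|C| == 2}.
Implicit Types (x y : V) (C D T : {set V}) (S : {set {set V}}).

Definition triples : {set {set V}} :=
  [set T : {set V} | (#|T| == 3) && (pairs T \subset P)].

Lemma mem_triples3 x y z : x != y -> x != z -> y != z ->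
  ([set x; y; z] \in triples) =
  [&& [set x; y] \in P, [set x; z] \in P & [set y; z] \in P].
Proof.
move=> xy xz yz; rewrite inE pairs3 // !subUset !sub1set -andbA.
by case: card3P => // -[]; exists x, y, z.
Qed.

Lemma cover_pairs T : #|T| == 3 -> cover (pairs T) = T.
Proof.
case/card3P => x [y [z [xy xz yz ->]]]; rewrite pairs3 // /cover !bigcup_setU !big_set1.
by apply/setP => v; rewrite !inE; do 3!case: (v == _).
Qed.

Lemma card_pairs T : #|T| == 3 -> #|pairs T| = 3.
Proof. by move=> /eqP T3; rewrite cards_draws T3. Qed.

Lemma sum_pair_rank1 (R : nmodType) (F : {set {set V}} -> R) :
  (\sum_(S : {set {set V}} | (S \subset P) && (pair_rank S == 1%N)) F S
   = \sum_(C in P) F [set C])%R.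
Proof.
rewrite -(big_imset F (_ : {in P &, injective set1})); last by move=> ? ? _ _ /set1_inj.
apply: eq_bigl => S; apply/andP/imsetP => [[sSP]|[C CP ->]]; last first.
  by rewrite sub1set CP pair_rank1 ?card_P.
rewrite pair_rank_eq1; last by move=> C /(subsetP sSP)/card_P.
by case/cards1P => C eS; exists C; rewrite // -sub1set -eS.
Qed.

(** The two cases of rank 2 are exclusive, since a triangle has three pairs, and a triangle is
    recovered from its pairs as their [cover]. *)
Lemma sum_pair_rank2 (R : nmodType) (F : {set {set V}} -> R) :
  (\sum_(S : {set {set V}} | (S \subset P) && (pair_rank S == 2)) F S
   = \sum_(S : {set {set V}} | (S \subset P) && (#|S| == 2)) F S
     + \sum_(T in triples) F (pairs T))%R.
Proof.
have inj : {in triples &, injective (@pairs V)}.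
  move=> T T' /[!inE] /andP[T3 _] /andP[T3' _] e.
  by rewrite -(cover_pairs T3) e cover_pairs.
rewrite -(big_imset F inj) (bigID (fun S => #|S| == 2)) /=; congr (_ + _)%R;
  apply: eq_bigl => S.
  rewrite -andbA; case: (boolP (S \subset P)) => //= sSP.
  rewrite pair_rank_eq2; last by move=> C /(subsetP sSP)/card_P.
  by rewrite andbC; case: (_ == 2).
rewrite -andbA; apply/and3P/imsetP => [[sSP + nS]|[T]].
  rewrite pair_rank_eq2 ?(negPf nS); last by move=> C /(subsetP sSP)/card_P.
  case/existsP => T /andP[T3 /eqP eS]; exists T => //.
  by rewrite inE T3 -eS.
rewrite inE => /andP[T3 sT] ->; rewrite sT card_pairs //; split => //.
rewrite pair_rank_eq2; last by move=> C /(subsetP sT)/card_P.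
by apply/orP; right; apply/existsP; exists T; rewrite T3 eqxx.
Qed.

(** Such sets correspond to the choice of the second pair [D] in [P :\ C]. *)
Lemma card_pairs_at C : C \in P ->
  #|[set S : {set {set V}} | (S \subset P) && (#|S| == 2) & C \in S]| = #|P|.-1.
Proof.
move=> CP; have := cardsD1 C P; rewrite CP add1n => -> /=.
rewrite -(@card_in_imset _ _ (fun D => [set C; D])); last first.
  move=> D D' /setD1P [DC _] /setD1P [DC' _] e.
  have : D \in [set C; D'] by rewrite -e set22.
  by rewrite !inE (negPf DC) => /eqP.
apply: eq_card => S; rewrite inE; apply/andP/imsetP.
  case=> /andP[sSP S2] CS; have := cardsD1 C S; rewrite CS (eqP S2).
  case=> /esym/eqP/cards1P [D eD]; have : D \in S :\ C by rewrite eD set11.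
  case/setD1P => DC DS; exists D; first by rewrite !inE DC (subsetP sSP).
  by rewrite -(setD1K CS) eD.
case=> D /setD1P [DC DP] ->.
by rewrite subUset !sub1set CP DP set21 cards2 (eq_sym C) DC.
Qed.

Lemma pair_other D x : #|D| == 2 -> x \in D -> exists2 y, x != y & D = [set x; y].
Proof.
move=> /cards2P [u [v [uv ->]]] /set2P [] ->; first by exists v.
by exists u; rewrite 1?eq_sym // setUC.
Qed.

(* Contracting the pair [C] merges two other pairs exactly when they form a
   triangle with [C], and no three pairs are merged together. *)
Lemma card_pair_contr (r : V -> V) C : C \in P ->
  (forall x y, (r x == r y) = (x == y) || (C == [set x; y])) ->
  #|[set r @: (D : {set V}) | D in P :\ C]|
    + #|[set T in triples | C \in pairs T]| = #|P|.-1.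
Proof.
move=> CP rE; have C2 := card_P CP; have /cards2P [s [t [st eC]]] := C2.
have sC : s \in C by rewrite eC set21.
have tC : t \in C by rewrite eC set22.
(* The common neighbours of the two ends of [C], that is, the apexes of the triangles on [C]. *)
pose K := [set w | [&& w \notin C, [set s; w] \in P & [set t; w] \in P]].
have KE w : w \in K -> [/\ s != w, t != w, [set s; w] \in P & [set t; w] \in P].
  by rewrite inE eC !inE negb_or (eq_sym w s) (eq_sym w t) => /and3P[/andP[-> ->] -> ->].
(* Each apex [w] gives a couple of pairs merged by [r]; [L] takes from each couple the member
   through [s], to be discarded. *)
pose L := [set [set s; w] | w in K].
have cardL : #|L| = #|K|.
  rewrite card_in_imset // => w w' /KE [sw _ _ _] _ e.
  have : w \in [set s; w'] by rewrite -e set22.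
  by rewrite !inE eq_sym (negPf sw) => /eqP.
have cardT : #|[set T in triples | C \in pairs T]| = #|K|.
  rewrite -(@card_in_imset _ _ (fun w => [set s; t; w])); last first.
    move=> w w' /KE [sw tw _ _] _ e.
    have : w \in [set s; t; w'] by rewrite -e !inE eqxx !orbT.
    by rewrite !inE (eq_sym w s) (eq_sym w t) (negPf sw) (negPf tw) => /eqP.
  apply: eq_card => T; apply/setIdP/imsetP => [[TT]|[w wK ->]]; last first.
    have [sw tw swP twP] := KE _ wK; rewrite mem_triples3 // -eC CP swP twP.
    by rewrite inE C2 eC subUset !sub1set !inE !eqxx orbT.
  rewrite inE => /andP[CT _]; have := TT; rewrite inE => /andP[T3 _].
  have := cardsID C T; rewrite (setIidPr CT) (eqP C2) (eqP T3) => -[] /eqP/cards1P [w ew].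
  have : w \in T :\: C by rewrite ew set11.
  case/setDP => wT wC; have eT : T = [set s; t; w].
    by rewrite -(setID T C) (setIidPr CT) ew eC.
  exists w => //; have := wC; rewrite eC !inE negb_or (eq_sym w s) (eq_sym w t) => /andP[sw tw].
  by move: TT; rewrite eT mem_triples3 // => /and3P[_ swP twP]; rewrite wC swP twP.
have sLP : L \subset P :\ C.
  apply/subsetP => D /imsetP [w wK ->]; have [sw tw swP _] := KE _ wK.
  rewrite !inE swP andbT; apply/eqP => /setP /(_ t).
  by rewrite tC !inE eq_sym (negPf st) (negPf tw).
pose U := (P :\ C) :\: L.
have imU : [set r @: (D : {set V}) | D in P :\ C] = [set r @: (D : {set V}) | D in U].
  apply/eqP; rewrite eqEsubset andbC imsetS ?subsetDl //=.
  apply/subsetP => _ /imsetP [D DP ->].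
  case: (boolP (D \in L)) => DL; last by rewrite imset_f // inE DL.
  have /imsetP [w wK ->] := DL; have [sw tw swP twP] := KE _ wK.
  have -> : r @: [set s; w] = r @: [set t; w].
    by rewrite !imsetU1 !imset_set1; congr [set _; _]; apply/eqP; rewrite rE eC eqxx orbT.
  have sn : s \notin [set t; w] by rewrite !inE negb_or st sw.
  apply: imset_f; rewrite !inE twP andbT; apply/andP; split.
    by apply: contraNN sn => /imsetP [w' _ ->]; rewrite set21.
  by apply: contraNneq sn => ->.
(* If two distinct pairs have the same image, one contains [s], the other [t], and their other end
   is a common [w] in [K]; the one through [s] then lies in [L], which [U] excludes. *)
have injU : {in U &, injective (fun D : {set V} => r @: D)}.
  move=> D D' DU D'U e; have /setDP [/setD1P [DC DP] DL] := DU.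
  have /setDP [/setD1P [DC' DP'] DL'] := D'U.
  apply: pair_sub; rewrite ?card_P //; apply/subsetP => x xD; apply: contraT => xD'.
  have : r x \in r @: D' by rewrite -e imset_f.
  case/imsetP => y yD' /eqP; rewrite rE; case: eqP => [xy|_ /= /eqP exy].
    by rewrite xy yD' in xD'.
  have [w xw eD] := pair_other (card_P DP) xD.
  have [w' yw' eD'] := pair_other (card_P DP') yD'.
  have wC : w \notin C.
    rewrite exy !inE eq_sym (negPf xw) /=; apply: contraNneq DC => wy.
    by rewrite exy eD wy.
  have yC : y \in C by rewrite exy set22.
  have : r w \in r @: D' by rewrite -e imset_f // eD set22.
  case/imsetP => v vD' /eqP; rewrite rE.
  rewrite [C == _](_ : _ = false); last by apply: contraNF wC => /eqP ->; rewrite set21.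
  rewrite orbF => /eqP wv; rewrite -wv eD' in vD'.
  have ww' : w = w'.
    by case/set2P: vD' => // wy; rewrite wy yC in wC.
  have xC : x \in C by rewrite exy set21.
  have wK : w \in K.
    rewrite inE wC; have := exy; rewrite eC => /setP exy'.
    rewrite eD -?ww' in DP; rewrite eD' -ww' in DP'.
    move: xC yC; rewrite eC => /set2P[] ex /set2P[] ey; rewrite ex in DP; rewrite ey in DP'; 
      rewrite ?DP ?DP' //.
      by move: (exy' t); rewrite ex ey !inE eqxx orbT eq_sym (negPf st).
    by move: (exy' s); rewrite ex ey !inE eqxx (negPf st).
  suff : D \in L \/ D' \in L by rewrite (negPf DL) (negPf DL') => -[].
  move: sC; rewrite exy => /set2P [] es; [left|right].
    by rewrite eD -es; apply/imsetP; exists w.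
  by rewrite eD' -ww' -es; apply/imsetP; exists w.
rewrite cardT imU card_in_imset // -cardL cardsD (setIidPr sLP) subnK ?subset_leq_card //.
by have := cardsD1 C P; rewrite CP add1n => ->.
Qed.

End PairCounts.

Local Open Scope ring_scope.

(** * Generating functions *)

Section ImsetSum.
Variable R : comNzRingType.

(** Expand a product over all of [I] whose factor off [B] is [0 + 1]: the choices [A] not inside [B]
    vanish. *)
Lemma sum_subset_expr (I : finType) (B : {set I}) (q : R) :
  \sum_(A : {set I} | A \subset B) q ^+ #|A| = (1 + q) ^+ #|B|.
Proof.
have -> : (1 + q) ^+ #|B| = \prod_i ((if i \in B then q else 0) + 1).
  rewrite -prodr_const big_mkcond; apply: eq_bigr => i _.
  by case: ifP; rewrite ?add0r // addrC.
rewrite bigA_distr big_mkcond; apply: eq_bigr => A _.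
case: ifP => [/subsetP sAB|/negbT/subsetPn [i iA iB]]; last first.
  by rewrite (bigD1 i) //= iA (negPf iB) mul0r.
rewrite -prodr_const big_mkcond; apply: eq_bigr => i _.
by case: ifP => // /sAB ->.
Qed.

(** A set with image [S] amounts to an independent choice of a nonempty subset of each fibre over
    [S]; the [- 1] removes the empty subset. *)
Lemma sum_imset_expr (I J : finType) (f : I -> J) (S : {set J}) (q : R) :
  \sum_(A : {set I} | f @: A == S) q ^+ #|A| =
  \prod_(C in S) ((1 + q) ^+ #|[set i | f i == C]| - 1).
Proof.
pose fib C := [set i | f i == C].
(* Admissible traces on the fibre of [C]: nonempty when [C] is in [S], empty otherwise. *)
pose Q C (B : {set I}) := (B \subset fib C) && ((B != set0) == (C \in S)).
transitivity (\prod_C \sum_(B | Q C B) q ^+ #|B|); last first.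
  rewrite [RHS]big_mkcond; apply: eq_bigr => C _; rewrite /Q.
  case: (C \in S); last first.
    rewrite (big_pred1 set0) ?cards0 // => B; rewrite /= eqbF_neg negbK.
    by case: eqP => [->|]; rewrite ?sub0set ?andbF.
  rewrite -sum_subset_expr [X in _ = X - 1](bigD1 set0) ?sub0set //= cards0.
  rewrite expr0 addrAC subrr add0r; apply: eq_bigl => B.
  by rewrite eqb_id.
rewrite bigA_distr_big_dep.
(* [h] cuts a set into its traces on the fibres and [h'] glues them together again. *)
pose h (A : {set I}) : {ffun J -> {set I}} := [ffun C => A :&: fib C].
pose h' (g : {ffun J -> {set I}}) := \bigcup_C g C.
have hK A : h' (h A) = A.
  apply/setP => i; apply/bigcupP/idP => [[C _]|iA]; first by rewrite ffunE => /setIP[].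
  by exists (f i); rewrite // ffunE !inE iA eqxx.
rewrite [RHS](reindex_onto h h') /=.
  apply: eq_big => [A|A _].
    rewrite hK eqxx andbT; apply/eqP/familyP => [eS C|H].
      rewrite unfold_in /Q ffunE subsetIr -eS /=; apply/eqP; apply/set0Pn/imsetP.
        by case=> i; rewrite !inE => /andP[iA /eqP <-]; exists i.
      by case=> i iA ->; exists i; rewrite !inE iA eqxx.
    apply/setP => C; have := H C; rewrite unfold_in /Q ffunE subsetIr /= => /eqP <-.
    apply/imsetP/set0Pn.
      by case=> i iA ->; exists i; rewrite !inE iA eqxx.
    by case=> i; rewrite !inE => /andP[iA /eqP <-]; exists i.
  rewrite prodrXr; congr (_ ^+ _).
  rewrite -sum1_card (partition_big f predT) //=; apply: eq_bigr => C _.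
  by rewrite ffunE -sum1_card; apply: eq_bigl => i; rewrite !inE.
move=> g /familyP H; apply/ffunP => C; rewrite ffunE; apply/setP => i.
have sub D : g D \subset fib D by have := H D; rewrite unfold_in => /andP[].
rewrite !inE; apply/andP/idP => [[/bigcupP [D _ iD] /eqP <-]|iC].
  by have := subsetP (sub D) _ iD; rewrite inE => /eqP ->.
split; first by apply/bigcupP; exists C.
by have := subsetP (sub C) _ iC; rewrite inE.
Qed.

End ImsetSum.

Lemma coef1M (R : nzSemiRingType) (p q : {poly R}) :
  (p * q)`_1 = p`_0 * q`_1 + p`_1 * q`_0.
Proof. by rewrite coefM big_ord_recl big_ord1. Qed.

Lemma coef1_prod (R : comNzSemiRingType) (I : finType) (F : I -> {poly R}) (A : {pred I}) :
  {in A, forall i, (F i)`_0 = 1} ->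
  (\prod_(i in A) F i)`_1 = \sum_(i in A) (F i)`_1.
Proof.
(* The linear coefficient alone does not pass through products, so it is tracked together with the
   constant coefficient 1. *)
move=> F0; pose K (p : {poly R}) s := p`_0 = 1 /\ p`_1 = s.
suff [] : K (\prod_(i in A) F i) (\sum_(i in A) (F i)`_1) by [].
apply: (big_ind2 K) => [|p s p' s' [p0 p1] [p0' p1']|i iA]; rewrite /K ?coef1 //.
  by rewrite coef0M coef1M p0 p0' p1 p1' !mul1r mulr1 addrC.
by rewrite F0.
Qed.

Lemma coef_Xsub1_exp (R : comNzRingType) (m i : nat) :
  (('X - 1 : {poly R}) ^+ m)`_i = (-1) ^+ (m - i) *+ 'C(m, i).
Proof.
rewrite addrC exprDn coef_sum.
under eq_bigr => j _.
  rewrite -polyC1 -polyCN -polyC_exp coefMn coefCM coefXn mulr_natr -mulrnA; over.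
case: (ltnP i m.+1) => im; last first.
  rewrite bin_small // mulr0n big1 // => j _.
  by rewrite (gtn_eqF (leq_trans (ltn_ord j) im)) mul0n mulr0n.
rewrite (bigD1 (Ordinal im)) //= eqxx mul1n big1 ?addr0 // => j /negPf.
by rewrite -val_eqE /= eq_sym => ->.
Qed.

(** * Parallel classes as fibres of the endpoint map *)

Section ParallelClasses.
Variables (V E : finType) (s t : E -> V).
Local Notation ends := (endset s t).

Definition fiber (C : {set V}) : {set E} := [set e | ends e == C].

(** Stated for arbitrary endpoint maps and edge sets, so that it also counts the classes of a
    contraction. *)
Lemma card_pclasses (F : {set E}) : #|pclasses s t F| = #|ends @: F|.
Proof.
rewrite -(@card_in_imset _ _ (fun C => [set f in F | ends f == C])).
  by rewrite -imset_comp.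
move=> _ _ /imsetP [e eF ->] /imsetP [e' _ ->] /setP /(_ e).
by rewrite !inE eF eqxx => /esym/eqP.
Qed.

Lemma pclassesT : pclasses s t setT = fiber @: (ends @: setT).
Proof.
rewrite /pclasses -imset_comp; apply: eq_imset => e.
by apply/setP => f; rewrite !inE.
Qed.

Lemma fiber_inj : {in ends @: setT &, injective fiber}.
Proof.
move=> _ _ /imsetP [e _ ->] /imsetP [e' _ ->] /setP /(_ e).
by rewrite !inE eqxx => /esym/eqP.
Qed.

Lemma sum_pclasses (R : nmodType) (Q : pred {set E}) (G : {set E} -> R) :
  \sum_(A in pclasses s t setT | Q A) G A =
  \sum_(C in ends @: setT | Q (fiber C)) G (fiber C).
Proof.
by rewrite pclassesT big_mkcondr big_imset /= -?big_mkcondr //; apply: fiber_inj.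
Qed.

End ParallelClasses.

(** * The Tutte polynomial by rank *)

Section RankGenerating.
Variables (V E : finType) (src tgt : E -> V).
Local Notation ends := (endset src tgt).
Local Notation P := (ends @: setT).
Local Notation rank := (rk src tgt).
Local Notation fib := (fiber src tgt).

(** Here orientation and multiplicity of edges disappear: ranks become ranks of sets of pairs. *)
Lemma adjA_pair (A : {set E}) : adjA src tgt A =2 pair_adj (ends @: A).
Proof.
move=> x y; rewrite /pair_adj; apply/existsP/imsetP => -[e].
  case/andP => eA exy; exists e => //; rewrite /endset.
  by case/orP: exy => /andP[/eqP -> /eqP ->] //; rewrite setUC.
move=> eA e_xy; exists e; rewrite eA /=.
have: src e \in [set x; y] by rewrite e_xy set21.
have: tgt e \in [set x; y] by rewrite e_xy set22.
have: x \in ends e by rewrite -e_xy set21.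
have: y \in ends e by rewrite -e_xy set22.
rewrite !inE ![_ == src e]eq_sym ![_ == tgt e]eq_sym.
by do 4!case: (_ == _).
Qed.

Lemma rkE (A : {set E}) : rank A = pair_rank (ends @: A).
Proof.
by rewrite /rk /ncomp (eq_n_comp (eq_connect (adjA_pair A))).
Qed.

Hypothesis Hloop : loopless src tgt.

Lemma ends2 : {in P, forall C : {set V}, #|C| == 2}.
Proof. by move=> _ /imsetP [e _ ->]; rewrite cards2 Hloop. Qed.

Lemma ends2_sub (A : {set E}) : {in ends @: A, forall C : {set V}, #|C| == 2}.
Proof. by move=> C /(subsetP (imsetS _ (subsetT A))) /ends2. Qed.

(** Both truncated subtractions are true ones: there are at most [#|V|] components, and the rank is
    at most the number of distinct endpoint pairs, hence at most [#|A|]. *)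
Lemma rk_nullity (A : {set E}) : (rank A + nullity src tgt A)%N = #|A|.
Proof.
have le1 : (rank A <= #|A|)%N.
  by rewrite rkE (leq_trans (pair_rank_le (ends2_sub (A := A)))) // leq_imset_card.
have le2 : (ncomp src tgt A <= #|V|)%N by exact: max_card.
move: le1; rewrite /rk /nullity leq_subLR => le1.
by rewrite addnC addnBA // subnK ?addnK // addnC.
Qed.

Lemma rk_mono (A : {set E}) : (rank A <= rank setT)%N.
Proof.
by rewrite !rkE; have /andP[] := pair_rank_mono ends2 (imsetS ends (subsetT A)).
Qed.

(** The polynomial [W_k] in [y]. *)
Definition rank_gen (k : nat) : {poly int} :=
  \sum_(A : {set E} | rank A == k) ('X - 1) ^+ nullity src tgt A.

(** The quotient of [y^k - 1] by [y - 1]. *)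
Definition geom (k : nat) : {poly int} := \poly_(i < k) 1.

(** The factor [q^k] turns the exponent [nullity A] into [#|A|], after which the sum over all [A]
    with given endpoint pairs factors over the parallel classes. *)
Lemma rank_genE k : ('X - 1) ^+ k * rank_gen k =
  \sum_(S : {set {set V}} | (S \subset P) && (pair_rank S == k))
    ('X - 1) ^+ #|S| * \prod_(C in S) geom #|fib C|.
Proof.
rewrite /rank_gen mulr_sumr (partition_big (fun A : {set E} => ends @: A)
  (fun S : {set {set V}} => (S \subset P) && (pair_rank S == k))) /=; last first.
  by move=> A; rewrite rkE imsetS ?subsetT.
apply: eq_bigr => S /andP[_ /eqP rS].
transitivity (\sum_(A : {set E} | ends @: A == S) (('X - 1) ^+ #|A| : {poly int})).
  apply: eq_big => [A|A /andP[/eqP rA _]]; last by rewrite -exprD -rA rk_nullity.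
  by rewrite rkE; case: (_ =P S) => [->|]; rewrite ?rS ?eqxx ?andbF.
rewrite sum_imset_expr -prodr_const -big_split; apply: eq_bigr => C _ /=.
rewrite [1 + _]addrC subrK subrX1; congr (_ * _).
by rewrite /geom poly_def; apply: eq_bigr => i _; rewrite scale1r.
Qed.

Lemma Xsub1_neq0 k : ('X - 1) ^+ k != 0 :> {poly int}.
Proof. by rewrite expf_neq0 // -size_poly_eq0 size_XsubC. Qed.

Lemma rank_gen0 : rank_gen 0 = 1.
Proof.
rewrite -[LHS]mul1r -(expr0 ('X - 1)) rank_genE (big_pred1 set0).
  by rewrite cards0 expr0 mul1r big_set0.
move=> S /=; case: (boolP (S \subset P)) => /= [/subsetP sSP|].
  by rewrite pair_rank_eq0 // => C /sSP/ends2.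
by move=> nS; apply/esym; apply: contraNF nS => /eqP ->; rewrite sub0set.
Qed.

Lemma rank_gen1 : rank_gen 1 = \sum_(C in P) geom #|fib C|.
Proof.
apply: (mulfI (Xsub1_neq0 1)); rewrite rank_genE (sum_pair_rank1 ends2) mulr_sumr.
by apply: eq_bigr => C _; rewrite cards1 big_set1.
Qed.

(** Two pairs carry exactly the factor [q^2] that is cancelled; a triangle carries [q^3], so one
    factor [q] survives. *)
Lemma rank_gen2 : rank_gen 2 =
  \sum_(S : {set {set V}} | (S \subset P) && (#|S| == 2)) \prod_(C in S) geom #|fib C|
  + ('X - 1) * \sum_(T in triples P) \prod_(C in pairs T) geom #|fib C|.
Proof.
apply: (mulfI (Xsub1_neq0 2)); rewrite rank_genE (sum_pair_rank2 ends2) mulrDr.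
congr (_ + _); first by rewrite mulr_sumr; apply: eq_bigr => S /andP[_ /eqP ->].
rewrite mulrA -exprSr mulr_sumr; apply: eq_bigr => T.
by rewrite inE => /andP[T3 _]; rewrite card_pairs.
Qed.

Lemma fib_gt0 C : C \in P -> (0 < #|fib C|)%N.
Proof.
by case/imsetP => e _ ->; apply/card_gt0P; exists e; rewrite inE.
Qed.

Lemma geom_coef0 C : C \in P -> (geom #|fib C|)`_0 = 1.
Proof. by move=> CP; rewrite coef_poly fib_gt0. Qed.

Definition nontriv (C : {set V}) : int := (1 < #|fib C|)%N%:R.

Lemma geom_coef1 C : (geom #|fib C|)`_1 = nontriv C.
Proof. by rewrite coef_poly /nontriv; case: ltnP. Qed.

Lemma prod_coef0 (S : {set {set V}}) : S \subset P -> (\prod_(C in S) geom #|fib C|)`_0 = 1.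
Proof.
move=> /subsetP sSP; rewrite coef0_prod big1 // => C /sSP; exact: geom_coef0.
Qed.

Lemma prod_coef1 (S : {set {set V}}) : S \subset P ->
  (\prod_(C in S) geom #|fib C|)`_1 = \sum_(C in S) nontriv C.
Proof.
move=> /subsetP sSP; rewrite coef1_prod => [|C /sSP]; last exact: geom_coef0.
by apply: eq_bigr => C _; rewrite geom_coef1.
Qed.

(** * The invariants of the graph in terms of endpoint pairs *)

Lemma nparE : npar src tgt = #|P|.
Proof. exact: card_pclasses. Qed.

Lemma ntrianglesE : ntriangles src tgt = #|triples P|.
Proof.
apply: eq_card => T; rewrite !inE; case: eqP => //= _.
apply/'forall_implyP/subsetP => [H C|H x xT].
  rewrite inE => /andP[CT /cards2P [x [y [xy eC]]]].
  move: CT; rewrite eC subUset !sub1set => /andP[xT yT].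
  have /forall_inP/(_ y yT)/implyP/(_ xy)/andP[_ /existsP [e /eqP <-]] := H x xT.
  exact: imset_f.
apply/forall_inP => y yT; apply/implyP => xy; rewrite /sadj xy.
have /H /imsetP [e _ ->] : [set x; y] \in pairs T.
  by rewrite inE cards2 xy subUset !sub1set xT yT.
by apply/existsP; exists e.
Qed.

Lemma npar_nontrivE : (npar_nontriv src tgt)%:Z = \sum_(C in P) nontriv C.
Proof.
rewrite -natz /npar_nontriv -sum1dep_card natr_sum sum_pclasses big_mkcondr.
by apply: eq_bigr => C _; rewrite /nontriv; case: ltnP.
Qed.

(** The map to component roots identifies exactly the two ends of [C], and the edges that remain are
    those with endpoint pair in [P :\ C], so [card_pair_contr] applies. *)
Lemma npar_contrE C : C \in P ->
  (npar_contr src tgt (fib C) + #|[set T in triples P | C \in pairs T]|)%N = #|P|.-1.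
Proof.
move=> CP; pose r := fingraph.root (adjA src tgt (fib C)).
have eC : ends @: fib C = [set C].
  apply/setP => D; rewrite inE; apply/imsetP/eqP => [[e]|->].
    by rewrite inE => /eqP -> ->.
  by case/imsetP: CP => e _ ->; exists e; rewrite ?inE.
have sym : connect_sym (adjA src tgt (fib C)).
  by move=> x y; rewrite !(eq_connect (adjA_pair _)) connect_pair_sym.
rewrite -(card_pair_contr ends2 (r := r) CP); last first.
  move=> x y; rewrite /r root_connect // (eq_connect (adjA_pair _)) eC.
  by rewrite connect_pair1 ?ends2.
congr (_ + _)%N; rewrite /npar_contr card_pclasses; apply: eq_card => D.
apply/imsetP/imsetP => [[e eC' ->]|[D' /setD1P [DC /imsetP [e _ eD]] ->]].
  exists (ends e); first by rewrite !inE imset_f // andbT; rewrite !inE in eC'.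
  by rewrite /endset imsetU1 imset_set1.
exists e; first by rewrite !inE -eD.
by rewrite eD /endset imsetU1 imset_set1.
Qed.

(** * Constant and linear coefficients of [W_1] and [W_2] *)

Lemma rank_gen1_coef0 : (rank_gen 1)`_0 = (npar src tgt)%:Z.
Proof.
rewrite rank_gen1 coef_sum (eq_bigr (fun=> 1)); last exact: geom_coef0.
by rewrite sumr_const nparE natz.
Qed.

Lemma rank_gen1_coef1 : (rank_gen 1)`_1 = (npar_nontriv src tgt)%:Z.
Proof.
by rewrite rank_gen1 coef_sum npar_nontrivE; apply: eq_bigr => C _; rewrite geom_coef1.
Qed.

Lemma triples_sub T : T \in triples P -> pairs T \subset P.
Proof. by rewrite inE => /andP[]. Qed.

(** At [y = 0] every product of [geom] factors is 1 and [q] is -1, so each triangle counts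
    negatively. *)
Lemma rank_gen2_coef0 :
  (rank_gen 2)`_0 = ('C(npar src tgt, 2))%:Z - (ntriangles src tgt)%:Z.
Proof.
rewrite rank_gen2 coefD coef0M !coef_sum coefB coefX coef1 sub0r mulN1r.
rewrite (eq_bigr (fun=> 1)) => [|S /andP[sSP _]]; last exact: prod_coef0.
rewrite [in X in _ - X](eq_bigr (fun=> 1)) => [|T /triples_sub]; last exact: prod_coef0.
rewrite !sumr_const !natz ntrianglesE nparE -cards_draws; congr (Posz _ - _).
by apply: eq_card => S; rewrite [RHS]inE.
Qed.

(** The linear coefficient of [q G] is [G_0 - G_1]. For triangles, [G_0] is their number, and [G_1]
    counts, for each non-trivial class, the triangles through it. *)
Lemma rank_gen2_coef1 : (rank_gen 2)`_1 =
  \sum_(A in pclasses src tgt setT | (1 < #|A|)%N) (npar_contr src tgt A)%:Z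
  + (ntriangles src tgt)%:Z.
Proof.
rewrite rank_gen2 coefD coef1M !coef_sum !coefB !coefX !coef1 /= sub0r subr0 mulN1r mul1r.
rewrite (eq_bigr (fun S : {set {set V}} => \sum_(C in S) nontriv C)) => [|S /andP[sSP _]];
  last exact: prod_coef1.
rewrite [in X in _ + (- X + _)]
  (eq_bigr (fun T => \sum_(C in pairs T) nontriv C)) => [|T /triples_sub];
  last exact: prod_coef1.
rewrite [X in _ + (_ + X)](eq_bigr (fun=> 1)) => [|T /triples_sub]; last exact: prod_coef0.
rewrite addrA sumr_const natz ntrianglesE; congr (_ + _).
rewrite sum_pclasses [RHS]big_mkcondr /=.
(* Count by class: a non-trivial [C] lies in [#|P|.-1] two-element sets, and subtracting the
   triangles through it leaves the number of classes after contraction. *)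
rewrite (exchange_big_dep (fun C => C \in P)) /=; last first.
  by move=> S C /andP[/subsetP sSP _] /sSP.
rewrite [X in _ - X](exchange_big_dep (fun C => C \in P)) /=; last first.
  by move=> T C /triples_sub/subsetP; apply.
rewrite -sumrB; apply: eq_bigr => C CP; rewrite !sumr_const.
have := card_pairs_at CP; rewrite -(npar_contrE CP) cardsE => ->.
rewrite -(cardsE (fun T => (T \in triples P) && (C \in pairs T))).
rewrite mulrnDr addrK /nontriv; case: ifP => _; rewrite ?mul0rn //.
exact: natz.
Qed.

(** * Extraction of the coefficients in [x] *)

(** In [(x - 1)^(r - rank A)] the power [x^(r - j)] exceeds the degree as soon as [rank A > j], so
    only the ranks up to [j] remain. *)
Lemma tutte_coef j i : (j <= rank setT)%N ->
  (tutte src tgt)`_(rank setT - j)`_i =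
  \sum_(k < j.+1) (-1) ^+ (j - k) *+ 'C(rank setT - k, j - k) * (rank_gen k)`_i.
Proof.
move=> jr; rewrite /tutte coef_sum.
transitivity ((\sum_(k < j.+1) \sum_(A : {set E} | rank A == k)
    (-1) ^+ (j - k) *+ 'C(rank setT - k, j - k) * ('X - 1) ^+ nullity src tgt A
    : {poly int})`_i).
  congr ((_ : {poly int})`_i); rewrite (exchange_big_dep predT) //=; apply: eq_bigr => A _.
  rewrite coefMC coef_Xsub1_exp; have rA := rk_mono A.
  case: (leqP (rank A) j) => Aj.
    rewrite (big_pred1 (Ordinal (Aj : (rank A < j.+1)%N))) //=.
    have -> : (rank setT - rank A - (rank setT - j) = j - rank A)%N.
      by rewrite subnAC subKn.
    rewrite -(@bin_sub _ (rank setT - j)) ?leq_sub2l //.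
    by congr (_ *+ 'C(_, _) * _); rewrite subnAC subKn.
  rewrite bin_small ?mulr0n ?mul0r; last by rewrite ltn_sub2l // (leq_trans Aj).
  by rewrite big_pred0 // => k; apply/negbTE; rewrite gtn_eqF // (leq_trans (ltn_ord k)).
rewrite coef_sum; apply: eq_bigr => k _; rewrite -mulr_sumr.
by rewrite -/(rank_gen k) -polyC1 -polyCN -polyC_exp -polyCMn coefCM.
Qed.

End RankGenerating.

(** * Assembly of the five coefficients *)

(** Serves the graphs of rank 0 or 1, where the index [n - 2] or [n - 3] can be negative. *)
Lemma rank_gen_gt (V E : finType) (src tgt : E -> V) (k : nat) :
  loopless src tgt -> (rk src tgt setT < k)%N -> rank_gen src tgt k = 0.
Proof.
move=> Hloop rk_lt; rewrite /rank_gen big_pred0 // => A.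
by apply/negbTE; rewrite ltn_eqF // (leq_ltn_trans (rk_mono Hloop A)).
Qed.

Theorem theorem2 (V E : finType) (src tgt : E -> V)
  (Hconn : connected src tgt) (Hloop : loopless src tgt)
  (Hbr : bridgeless src tgt) :
  let n : int := (#|V|)%:Z in
  let p : int := (npar src tgt)%:Z in
  let ps : int := (npar_nontriv src tgt)%:Z in
  let D : int := (ntriangles src tgt)%:Z in
  [/\ tcoef src tgt (n - 1) 0 = 1,
      tcoef src tgt (n - 2) 0 = p - n + 1,
      tcoef src tgt (n - 3) 0 =
        ('C(#|V|.-1, 2))%:Z - (n - 2) * p + ('C(npar src tgt, 2))%:Z - D,
      tcoef src tgt (n - 2) 1 = ps
    & tcoef src tgt (n - 3) 1 =
        - ps * (n - 2)
        + (\sum_(A in pclasses src tgt setT | (1 < #|A|)%N)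
              (npar_contr src tgt A)%:Z)
        + D].
Proof.
move=> n p ps D.
have W10 : (rank_gen src tgt 1)`_0 = p := rank_gen1_coef0 Hloop.
have W11 : (rank_gen src tgt 1)`_1 = ps := rank_gen1_coef1 Hloop.
have W20 := rank_gen2_coef0 Hloop; have W21 := rank_gen2_coef1 Hloop.
have W0 := rank_gen0 Hloop.
have coef := tutte_coef Hloop; have gt := rank_gen_gt Hloop.
have nV : #|V| = (rk src tgt setT).+1.
  rewrite /rk Hconn subn1 prednK //.
  (* The unique component has a root, so there is a vertex and the predecessor of [#|V|] is not
     truncated. *)
  by have := max_card (predI (roots (adjA src tgt setT)) predT); rewrite -Hconn.
rewrite /n nV; move: (rk src tgt setT) nV coef gt => r _ coef gt {n}.
set X := \sum_(A in pclasses _ _ _ | _) _ in W21 *.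
have c0 : tcoef src tgt (r.+1%:Z - 1) 0 = 1.
  have -> : r.+1%:Z - 1 = r by rewrite -addn1 PoszD addrK.
  have := coef 0 0 (leq0n r); rewrite subn0 /= => ->.
  by rewrite big_ord1 W0 coef1 subn0 bin0 expr0 mulr1.
have c1 i : tcoef src tgt (r.+1%:Z - 2) (Posz i) =
    (rank_gen src tgt 1)`_i - r%:Z * (1 : {poly int})`_i.
  (* For [r = 0] the index is -1 and [tcoef] is 0 by convention, in agreement with [W_1 = 0]. *)
  case: r coef gt {c0} => [|r] coef gt.
    by rewrite (gt 1) //= coef0 mul0r subr0.
  have -> : r.+2%:Z - 2 = r%:Z by rewrite -addn2 PoszD addrK.
  have := coef 1 i isT; rewrite subn1 /= => ->.
  rewrite !big_ord_recl big_ord0 W0 /bump /= !subn0 !bin1 subnn bin0 expr1 expr0.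
  by rewrite addr0 mul1r addrC mulNrn mulNr natz.
have c2 i : tcoef src tgt (r.+1%:Z - 3) (Posz i) =
    (rank_gen src tgt 2)`_i - (r%:Z - 1) * (rank_gen src tgt 1)`_i
     + ('C(r, 2))%:Z * (1 : {poly int})`_i.
  (* For [r <= 1] the index is negative and the right side vanishes too: [W_1 = W_2 = 0] if [r = 0],
     while for [r = 1] one has [W_2 = 0] and both [r - 1] and the binomial are 0. *)
  case: r coef gt {c0 c1} => [|[|r]] coef gt.
  - by rewrite (gt 1) // (gt 2) //= !coef0 mulr0 mul0r.
  - by rewrite (gt 2) //= !coef0 subrr !mul0r.
  have -> : r.+3%:Z - 3 = r%:Z by rewrite -addn3 PoszD addrK.
  have := coef 2 i isT; rewrite subn2 /= => ->.
  rewrite !big_ord_recl big_ord0 W0 /= -[bump 0 0]/1%N -[bump 0 1]/2%N.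
  rewrite !subn0 !subn1 subnn bin0 bin1 expr1 expr0.
  have -> : r.+2%:Z = r.+1%:Z + 1 by rewrite -addn1 PoszD.
  rewrite /= sqrrN expr1n mul1r mulNrn !natz; ring.
rewrite c0 !c1 !c2 W10 W11 W20 W21 !coef1 /=.
have -> : r.+1%:Z = r%:Z + 1 by rewrite -addn1 PoszD.
by split; ring.
Qed.
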